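(* $B^t=B^*$ and $K^t=(K^* )^{-1}$.
   Context: Let $\Gamma=(X,R)$ be a finite, undirected, connected, distance-regular graph without loops or multiple edges, with path-length distance $\partial$ and diameter $D\ge3$, intersection numbers $c_i,b_i$. Fix $b,\beta\in\mathbb C$ with $b\ne1$ and assume $\Gamma$ has classical parameters $(D,b,\alpha,\beta)$ with $\alpha=b-1$, i.e. $c_i=b^{i-1}\frac{b^i-1}{b-1}$, $b_i=(\beta+1-b^i)\frac{b^D-b^i}{b-1}$ ($0\le i\le D$). Fix $q\in\mathbb C$ with $q^2=b$. Let $E_0,\dots,E_D$ be the primitive idempotents of the Bose–Mesner algebra ordered so that Krein parameters equal intersection numbers ($q^h_{ij}=p^h_{ij}$); $\Gamma$ is $Q$-polynomial with respect to this ordering. Let $V=\mathbb C X$ be the standard module with Hermitian form $\langle u,v\rangle=u^t\overline v$. Fix a vertex $x$ and let $E^*_i$ be the diagonal matrix with $(y,y)$-entry $1$ if $\partial(x,y)=i$, else $0$. For $-1\le i,j\le D$ define $V^{\downarrow\downarrow}_{i,j}=(E^*_0V+\dots+E^*_iV)\cap(E_0V+\dots+E_jV)$, $V^{\uparrow\downarrow}_{i,j}=(E^*_DV+\dots+E^*_{D-i}V)\cap(E_0V+\dots+E_jV)$, $V^{\downarrow\uparrow}_{i,j}=(E^*_0V+\dots+E^*_iV)\cap(E_DV+\dots+E_{D-j}V)$, $V^{\uparrow\uparrow}_{i,j}=(E^*_DV+\dots+E^*_{D-i}V)\cap(E_DV+\dots+E_{D-j}V)$ (zero if $i=-1$ or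 $j=-1$). For $0\le i,j\le D$ let $\tilde V^{\mu\nu}_{i,j}$ be the orthogonal complement of $V^{\mu\nu}_{i-1,j}+V^{\mu\nu}_{i,j-1}$ in $V^{\mu\nu}_{i,j}$; for each $\mu,\nu\in\{\downarrow,\uparrow\}$, $V=\bigoplus_{i,j}\tilde V^{\mu\nu}_{i,j}$ (direct sum). Define $B,B^*,K,K^*\in\mathrm{Mat}_X(\mathbb C)$ as the unique matrices such that for all $0\le i,j\le D$: $B$ acts as $q^{i-j}I$ on $\tilde V^{\downarrow\uparrow}_{i,j}$; $B^*$ acts as $q^{j-i}I$ on $\tilde V^{\uparrow\downarrow}_{i,j}$; $K$ acts as $q^{i-j}I$ on $\tilde V^{\downarrow\downarrow}_{i,j}$; $K^*$ acts as $q^{i-j}I$ on $\tilde V^{\uparrow\uparrow}_{i,j}$. *)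

(* Defs.v *)
From HB Require Import structures.
From mathcomp Require Import all_boot all_order all_algebra.

Set Implicit Arguments.
Unset Strict Implicit.
Unset Printing Implicit Defensive.

Import Order.TTheory GRing.Theory Num.Theory.

Local Open Scope ring_scope.

Section Graph.
Variables (X : finType) (e : rel X).

Definition connected_simple_graph : Prop :=
  [/\ symmetric e, irreflexive e & forall x y, connect e x y].

(* Least length of an e-path from x to y; a shortest path has length < #|X|,
   and the junk value #|X| occurs only when y is not reachable from x. *)
Definition dist (x y : X) : nat :=
  find (fun n => [exists p : n.-tuple X, path e x p && (last x p == y)])
       (iota 0 #|X|).

Definition diameter : nat := \max_(x : X) \max_(y : X) dist x y.

Definition sphere_meet (x y : X) (i j : nat) : nat :=
  #|[set z | (dist x z == i) && (dist z y == j)]|.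

(* p^h_{ij}, read off an arbitrary pair at distance h (0 if there is none);
   meaningful when the graph is distance-regular. *)
Definition inter_num (h i j : nat) : nat :=
  if [pick u : X * X | dist u.1 u.2 == h] is Some u
  then sphere_meet u.1 u.2 i j else 0%N.

Definition distance_regular : Prop :=
  forall (x y : X) (i j : nat),
    sphere_meet x y i j = inter_num (dist x y) i j.

(* For i = 0 this is p^0_{1,0} = 0. *)
Definition c_num (i : nat) : nat := inter_num i 1 i.-1.
Definition b_num (i : nat) : nat := inter_num i 1 i.+1.

End Graph.

Section Classical.
Variables (F : fieldType) (X : finType) (e : rel X).

Definition gauss_int (b : F) (n : nat) : F := \sum_(k < n) b ^+ k.

Definition classical_parameters (D : nat) (b alpha beta : F) : Prop :=
  diameter e = D /\
  forall i : nat, (i <= D)%N ->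
    (c_num e i)%:R = gauss_int b i * (1 + alpha * gauss_int b i.-1) /\
    (b_num e i)%:R = (gauss_int b D - gauss_int b i)
                     * (beta - alpha * gauss_int b i).

Lemma gauss_intE (b : F) (n : nat) :
  b != 1 -> gauss_int b n = (b ^+ n - 1) / (b - 1).
Proof.
move=> b1; have nz : b - 1 != 0 by rewrite subr_eq0.
by apply: (mulIf nz); rewrite mulfVK // subrX1 mulrC.
Qed.

Lemma classical_parameters_affine (D : nat) (b beta : F) : b != 1 ->
  classical_parameters D b (b - 1) beta <->
  diameter e = D /\
  forall i : nat, (i <= D)%N ->
    (c_num e i)%:R = b ^+ i.-1 * ((b ^+ i - 1) / (b - 1)) /\
    (b_num e i)%:R = (beta + 1 - b ^+ i) * ((b ^+ D - b ^+ i) / (b - 1)).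
Proof.
move=> b1; have nz : b - 1 != 0 by rewrite subr_eq0.
have E i : (gauss_int b i * (1 + (b - 1) * gauss_int b i.-1)
             = b ^+ i.-1 * ((b ^+ i - 1) / (b - 1))) *
           ((gauss_int b D - gauss_int b i) * (beta - (b - 1) * gauss_int b i)
             = (beta + 1 - b ^+ i) * ((b ^+ D - b ^+ i) / (b - 1))).
  rewrite !gauss_intE // ![(b - 1) * _]mulrC !mulfVK // -mulrBl opprB.
  rewrite [1 + _]addrC subrK mulrC; split=> //.
  rewrite mulrC; congr (_ * (_ * _)); first by rewrite addrA.
  by rewrite addrA subrK.
by split=> -[dD H]; split=> // i /H; rewrite !E.
Qed.

End Classical.

Section Algebra.
Variables (C : numClosedFieldType) (X : finType) (e : rel X).

(* Mat_X(C) is 'M[C]_#|X| and C^X is 'cV[C]_#|X|, the vertices being indexed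
   through enum_val; matrices act on the left of column vectors. *)

Definition distance_matrix (k : nat) : 'M[C]_#|X| :=
  \matrix_(i, j) (dist e (enum_val i) (enum_val j) == k)%:R.

Definition bose_mesner : {vspace 'M[C]_#|X|} :=
  (\sum_(k < (diameter e).+1) <[distance_matrix k]>)%VS.

Definition idempotent_in (A : {vspace 'M[C]_#|X|}) (M : 'M[C]_#|X|) : Prop :=
  M \in A /\ M *m M = M.

Definition primitive_idempotent (M : 'M[C]_#|X|) : Prop :=
  [/\ idempotent_in bose_mesner M, M != 0 &
      forall P Q : 'M[C]_#|X|,
        idempotent_in bose_mesner P -> idempotent_in bose_mesner Q ->
        P *m Q = 0 -> Q *m P = 0 -> M = P + Q -> P = 0 \/ Q = 0].

Definition primitive_idempotents (D : nat) (E : 'I_D.+1 -> 'M[C]_#|X|) : Prop :=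
  injective E /\
  forall M : 'M[C]_#|X|, primitive_idempotent M <-> exists i, E i = M.

(* kr h i j is q^h_{ij}; map2_mx *%R is the entrywise product. *)
Definition krein_parameters (D : nat) (E : 'I_D.+1 -> 'M[C]_#|X|)
    (kr : 'I_D.+1 -> 'I_D.+1 -> 'I_D.+1 -> C) : Prop :=
  forall i j : 'I_D.+1,
    map2_mx *%R (E i) (E j) = (#|X|%:R)^-1 *: \sum_(h < D.+1) kr h i j *: E h.

Definition dual_idempotent (x : X) (k : nat) : 'M[C]_#|X| :=
  diag_mx (\row_j (dist e x (enum_val j) == k)%:R).

Definition hform (n : nat) (u v : 'cV[C]_n) : C :=
  (u^T *m map_mx Num.conj v) 0 0.

End Algebra.

Inductive direction := down | up.

Section Split.
Variables (C : numClosedFieldType) (n D : nat).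
Implicit Types (Es E : 'I_D.+1 -> 'M[C]_n) (mu nu : direction) (i j : int).

(* Membership of k in {0, .., i} for down, in {D - i, .., D} for up; both are
   empty for i = -1. *)
Definition in_segment mu i (k : 'I_D.+1) : bool :=
  match mu with
  | down => k%:Z <= i
  | up => D%:Z - i <= k%:Z
  end.

Definition partial_sum mu (F : 'I_D.+1 -> 'M[C]_n) i : {vspace 'cV[C]_n} :=
  (\sum_(k < D.+1 | in_segment mu i k)
     limg (linfun (mulmx (F k) : 'cV[C]_n -> 'cV[C]_n)))%VS.

Definition split_space Es E mu nu i j : {vspace 'cV[C]_n} :=
  (partial_sum mu Es i :&: partial_sum nu E j)%VS.

Definition split_tilde Es E mu nu i j (v : 'cV[C]_n) : Prop :=
  v \in split_space Es E mu nu i j /\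
  forall w : 'cV[C]_n,
    w \in (split_space Es E mu nu (i - 1) j
           + split_space Es E mu nu i (j - 1))%VS -> hform v w = 0.

Definition acts_on_split Es E mu nu (lam : int -> int -> C) (B : 'M[C]_n)
    : Prop :=
  forall (i j : 'I_D.+1) (v : 'cV[C]_n),
    split_tilde Es E mu nu i j v -> B *m v = lam i j *: v.

End Split.

(* Main.v *)
(* Write V_ij for the meet of the i-th partial sum of the E*_k V and the j-th partial sum of
   the E_k V, each taken in increasing or in decreasing order, and F_a for the sum of the V_ij
   with i + j = a. Since A is tridiagonal on the E*_k V and diagonal on the E_k V, and dually
   for A*, each F_a is invariant under all E_k and E*_k. Splitting a sum at index i shows that
   the part of V_ij in F_(i+j-1) lies in V_(i-1,j) + V_(i,j-1), so the split component (i,j) is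
   orthogonal to F_(i+j-1). Let G_c be the analogue of F_a with both orders reversed. A dimension
   count shows that the orthogonal complement of F_a is G_(2D-1-a). Hence split components (i,j)
   and (k,l) for opposite orders are orthogonal unless i + k = D and j + l = D, and both
   identities follow by comparing eigenvalues.

   In the graph, q^h_ij = p^h_ij makes the dual distance matrices satisfy the same three-term
   recurrence as the distance matrices, and q^1_ij = 0 for |i - j| > 1 makes A* tridiagonal. *)
Require Import Defs.
From mathcomp Require Import all_boot all_order all_algebra.
From mathcomp Require Import zify ring reals.
From mathcomp.real_closed Require Import complex.

Set Implicit Arguments.
Unset Strict Implicit.
Unset Printing Implicit Defensive.

Import Order.TTheory GRing.Theory Num.Theory.
Local Open Scope ring_scope.

(** * Flags and split decompositions *)

Section HermitianForm.
Variables (C : numClosedFieldType) (n : nat).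
Implicit Types (u v w : 'cV[C]_n) (U : {vspace 'cV[C]_n}).

Lemma hformE u v : hform u v = \sum_k u k 0 * (v k 0)^*.
Proof. by rewrite /hform mxE; apply: eq_bigr => k _; rewrite !mxE. Qed.

Lemma hformC u v : hform v u = (hform u v)^*.
Proof.
rewrite !hformE rmorph_sum; apply: eq_bigr => k _.
by rewrite rmorphM /= conjCK mulrC.
Qed.

Lemma hformDl u v w : hform (u + v) w = hform u w + hform v w.
Proof. by rewrite /hform linearD mulmxDl mxE. Qed.

Lemma hformZl c u w : hform (c *: u) w = c * hform u w.
Proof. by rewrite /hform linearZ /= -scalemxAl mxE. Qed.

Lemma hform0l w : hform 0 w = 0.
Proof. by rewrite /hform trmx0 mul0mx mxE. Qed.

Lemma hformBl u v w : hform (u - v) w = hform u w - hform v w.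
Proof. by rewrite hformDl -scaleN1r hformZl mulN1r. Qed.

Lemma hformDr u v w : hform u (v + w) = hform u v + hform u w.
Proof. by rewrite !(hformC _ u) hformDl rmorphD. Qed.

Lemma hform0r w : hform w 0 = 0.
Proof. by rewrite hformC hform0l rmorph0. Qed.

Lemma hform_sumr I (r : seq I) (P : pred I) u (f : I -> 'cV[C]_n) :
  hform u (\sum_(k <- r | P k) f k) = \sum_(k <- r | P k) hform u (f k).
Proof.
by apply: (big_morph (hform u)); [exact: hformDr | exact: hform0r].
Qed.

Lemma hform_conj u v :
  hform (map_mx Num.conj u) v = (hform u (map_mx Num.conj v))^*.
Proof.
rewrite !hformE rmorph_sum; apply: eq_bigr => k _.
by rewrite !mxE rmorphM /= conjCK.
Qed.

Lemma hform_eq0 v : hform v v = 0 -> v = 0.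
Proof.
rewrite hformE => /eqP; rewrite psumr_eq0; last by move=> k _; rewrite mul_conjC_ge0.
move=> /allP v0; apply/colP => k; rewrite mxE; apply/eqP.
by rewrite -mul_conjC_eq0; apply: (v0 k); rewrite mem_index_enum.
Qed.

(** Taken as the kernel of the matrix of conjugated basis vectors of [U], so that rank-nullity
    controls its dimension. *)
Definition orthv U : {vspace 'cV[C]_n} :=
  lker (linfun (mulmx (\matrix_(k < \dim U, l < n) ((vbasis U)`_k l 0)^*)
                : 'cV[C]_n -> 'cV[C]_(\dim U))).

Lemma orthvP U v :
  reflect (forall w, w \in U -> hform v w = 0) (v \in orthv U).
Proof.
have entry k : ((\matrix_(k < \dim U, l < n) ((vbasis U)`_k l 0)^*) *m v) k 0
               = hform v (vbasis U)`_k.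
  by rewrite hformE mxE; apply: eq_bigr => l _; rewrite mxE mulrC.
rewrite memv_ker lfunE /=; apply: (iffP eqP) => [M0 w Uw | vU].
  rewrite (coord_vbasis Uw) hform_sumr big1 // => k _.
  by rewrite hformC hformZl hformC -entry M0 mxE conjC0 mulr0 conjC0.
apply/colP => k; rewrite entry mxE vU //.
by apply/vbasis_mem/mem_nth; rewrite size_tuple.
Qed.

Lemma orthv_decomp U v : exists2 p, p \in U & v - p \in orthv U.
Proof.
have UU0 : (U :&: orthv U = 0)%VS.
  apply/eqP; rewrite -subv0; apply/subvP => u /memv_capP[Uu /orthvP/(_ u Uu)].
  by move/hform_eq0->; rewrite mem0v.
have UV : (U + orthv U = fullv)%VS.
  apply/eqP; rewrite eqEdim subvf dimv_disjoint_sum //=.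
  rewrite -(limg_ker_dim (linfun (mulmx (\matrix_(k < \dim U, l < n) ((vbasis U)`_k l 0)^*)
                : 'cV[C]_n -> 'cV[C]_(\dim U))) fullv) capfv addnC leq_add2r.
  by apply: leq_trans (dimvS (subvf _)) _; rewrite dimvf /dim /= muln1.
have /memv_addP[p Up [p' Up' ->]] : v \in (U + orthv U)%VS by rewrite UV memvf.
by exists p => //; rewrite addrC addKr.
Qed.

End HermitianForm.

(** * Flags attached to a resolution of the identity *)

Section Flags.
Variables (C : numClosedFieldType) (n D : nat).
Implicit Types (F Es E : 'I_D.+1 -> 'M[C]_n) (u v w : 'cV[C]_n) (i j a : int).
Implicit Types (U : {vspace 'cV[C]_n}) (M : 'M[C]_n).

(** The last two fields make each [F k] real symmetric: self-adjoint for [hform], with an image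
    closed under conjugation. *)
Record resolution F : Prop := Resolution {
  resolution_sum : \sum_k F k = 1%:M;
  resolution_mul : forall k l, F k *m F l = if k == l then F k else 0;
  resolution_tr : forall k, (F k)^T = F k;
  resolution_conj : forall k, map_mx Num.conj (F k) = F k }.

Definition stable M U := forall u, u \in U -> M *m u \in U.

Definition rev_family F k := F (rev_ord k).

Lemma resolution_rev F : resolution F -> resolution (rev_family F).
Proof.
case=> s m t c; split=> [|k l|k|k]; rewrite /rev_family //.
- by rewrite -s [RHS](reindex_inj rev_ord_inj).
- by rewrite m (inj_eq rev_ord_inj).
Qed.

Lemma rev_familyK F : rev_family (rev_family F) =1 F.
Proof. by move=> k; rewrite /rev_family rev_ordK. Qed.

Definition flag F i := partial_sum down F i.

Lemma eq_flag F G i : F =1 G -> flag F i = flag G i.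
Proof. by move=> FG; apply: eq_bigr => k _; rewrite FG. Qed.

Lemma partial_sum_up F i : partial_sum up F i = flag (rev_family F) i.
Proof.
rewrite /flag /partial_sum (reindex_inj rev_ord_inj).
apply: eq_bigl => k /=; rewrite subSS; have := ltn_ord k => kD.
by apply/idP/idP; lia.
Qed.

Section Resolution.
Variable F : 'I_D.+1 -> 'M[C]_n.
Hypothesis resF : resolution F.

Lemma resolution_vec v : v = \sum_k F k *m v.
Proof. by rewrite -mulmx_suml (resolution_sum resF) mul1mx. Qed.

Lemma mem_flagP i v :
  reflect (forall k : 'I_D.+1, i < k%:Z -> F k *m v = 0) (v \in flag F i).
Proof.
apply: (iffP idP) => [/memv_sumP[w wP ->] k ik | v0].
  rewrite mulmx_sumr big1 // => l li; have /memv_imgP[y _ ->] := wP l li.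
  rewrite lfunE /= mulmxA (resolution_mul resF); case: eqP => [kl|]; last by rewrite mul0mx.
  by move: li; rewrite -kl /= leNgt ik.
rewrite (resolution_vec v) (bigID (fun k : 'I_D.+1 => k%:Z <= i)) /= addrC big1 ?add0r.
  apply: memv_suml => k ki.
  apply: (subvP (sumv_sup k _ (subvv _))); first exact: ki.
  by apply/memv_imgP; exists v; rewrite ?memvf // lfunE.
by move=> k; rewrite -ltNge => /v0.
Qed.

Lemma flag_lt0 i : i < 0 -> flag F i = 0%VS.
Proof.
move=> i0; apply/eqP; rewrite -subv0; apply/subvP => v /mem_flagP v0.
by rewrite (resolution_vec v) big1 ?mem0v // => k _; apply: v0; lia.
Qed.

Lemma flag_geD i : D%:Z <= i -> flag F i = fullv.
Proof.
move=> iD; apply/eqP; rewrite eqEsubv subvf; apply/subvP => v _.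
by apply/mem_flagP => k ik; have := ltn_ord k; lia.
Qed.

Lemma flag_sub i j : i <= j -> (flag F i <= flag F j)%VS.
Proof.
move=> ij; apply/subvP => v /mem_flagP v0; apply/mem_flagP => k jk.
by apply: v0; apply: le_lt_trans jk.
Qed.

Lemma resolution_adj k u v : hform (F k *m u) v = hform u (F k *m v).
Proof.
by rewrite /hform trmx_mul (resolution_tr resF) map_mxM (resolution_conj resF) mulmxA.
Qed.

(** No index [k] satisfies both [k <= i] and [D - j <= k], so each [F k] kills [u] or [v]. *)
Lemma flag_orth i j u v : i + j < D%:Z ->
  u \in flag F i -> v \in flag (rev_family F) j -> hform u v = 0.
Proof.
move=> ijD /mem_flagP u0; rewrite -partial_sum_up => vj.
rewrite (resolution_vec v) hform_sumr big1 // => k _.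
case: (ltP i k%:Z) => [ik|ki]; first by rewrite -resolution_adj u0 ?hform0l.
have /memv_sumP[w wP ->] := vj.
rewrite mulmx_sumr big1 ?hform0r // => l lj; have /memv_imgP[y _ ->] := wP l lj.
rewrite lfunE /= mulmxA (resolution_mul resF); case: eqP => [kl|_]; last by rewrite mul0mx.
by move: lj; rewrite -kl /=; lia.
Qed.

Lemma orthv_stable k U : stable (F k) U -> stable (F k) (orthv U).
Proof.
move=> FU v /orthvP vU; apply/orthvP => w Uw.
by rewrite resolution_adj vU // FU.
Qed.

(** Truncating [v = \sum_k F k *m v] after index [i] gives [p]. The terms with [k > i] form the
    reversed flag at [D - 1 - i]. *)
Lemma flag_split i v : exists2 p, p \in flag F i &
  (v - p \in flag (rev_family F) (D%:Z - 1 - i)) /\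
  forall U, (forall k, stable (F k) U) -> v \in U -> p \in U.
Proof.
exists (\sum_(k < D.+1 | k%:Z <= i) F k *m v).
  apply: memv_suml => k ki; apply/mem_flagP => l il.
  rewrite mulmxA (resolution_mul resF); case: eqP => [lk|_]; last by rewrite mul0mx.
  by move: ki; rewrite -lk leNgt il.
split=> [|U FU Uv]; last by apply: memv_suml => k _; apply: FU.
rewrite -partial_sum_up {1}(resolution_vec v) (bigID (fun k : 'I_D.+1 => k%:Z <= i)) /=.
rewrite addrAC subrr add0r; apply: memv_suml => k ki.
apply: (subvP (sumv_sup k _ (subvv _))); first by rewrite /=; lia.
by apply/memv_imgP; exists v; rewrite ?memvf // lfunE.
Qed.

(** For [k > i] the vector [F k *m p] lies in [U] and [F k *m v = 0], so the orthogonality of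
    [v - p] to [F k *m p] says that [F k *m p] has norm zero. *)
Lemma flag_proj i U v p : (forall k, stable (F k) U) ->
  v \in flag F i -> p \in U -> v - p \in orthv U -> p \in flag F i.
Proof.
move=> FU /mem_flagP v0 Up /orthvP vp; apply/mem_flagP => k ik.
apply: hform_eq0; have := vp (F k *m p) (FU k _ Up).
rewrite -resolution_adj linearB /= (v0 _ ik) sub0r -scaleN1r hformZl.
rewrite resolution_adj => /eqP; rewrite mulrI_eq0; last by apply: mulrI; rewrite unitrN1.
rewrite -resolution_adj => /eqP p0.
by rewrite resolution_adj mulmxA (resolution_mul resF) eqxx -resolution_adj.
Qed.

Lemma flag_conj i v : v \in flag F i -> map_mx Num.conj v \in flag F i.
Proof.
move=> /mem_flagP v0; apply/mem_flagP => k ik.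
by rewrite -{1}(resolution_conj resF) -map_mxM v0 ?map_mx0.
Qed.

End Resolution.
End Flags.

(** * Diagonal sums of flag meets and orthogonality of opposite split components *)

Section Displacement.
Variables (C : numClosedFieldType) (n D : nat).
Implicit Types (F Es E : 'I_D.+1 -> 'M[C]_n) (u v w : 'cV[C]_n) (i j a : int).
Implicit Types (U : {vspace 'cV[C]_n}) (A M : 'M[C]_n).

(* In Terwilliger's terms A is the (dual) adjacency matrix: tridiagonal with respect to
   Es, diagonal with respect to E, and generating the algebra spanned by E. *)
Definition tridiagonal_pair_half Es E : Prop := exists A (theta : 'I_D.+1 -> C),
  [/\ forall k l : 'I_D.+1, (k.+1 < l)%N || (l.+1 < k)%N -> Es k *m A *m Es l = 0,
      forall k, A *m E k = theta k *: E k &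
      forall U, stable A U -> forall k, stable (E k) U].

Lemma tridiagonal_pair_half_revl Es E :
  tridiagonal_pair_half Es E -> tridiagonal_pair_half (rev_family Es) E.
Proof.
case=> A [theta [tri eig gen]]; exists A, theta; split=> // k l kl.
by apply: tri => /=; have := ltn_ord k; have := ltn_ord l; lia.
Qed.

Lemma tridiagonal_pair_half_revr Es E :
  tridiagonal_pair_half Es E -> tridiagonal_pair_half Es (rev_family E).
Proof.
case=> A [theta [tri eig gen]]; exists A, (fun k => theta (rev_ord k)); split=> //.
- by move=> k; apply: eig.
- by move=> U AU k; apply: gen.
Qed.

Record tridiagonal_pair Es E : Prop := TridiagonalPair {
  tdp_resl : resolution Es;
  tdp_resr : resolution E;
  tdp_halfl : tridiagonal_pair_half Es E;
  tdp_halfr : tridiagonal_pair_half E Es }.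

Lemma tdp_revl Es E : tridiagonal_pair Es E -> tridiagonal_pair (rev_family Es) E.
Proof.
case=> resl resr halfl halfr; split=> //; first exact: resolution_rev.
  exact: tridiagonal_pair_half_revl.
exact: tridiagonal_pair_half_revr.
Qed.

Lemma tdp_sym Es E : tridiagonal_pair Es E -> tridiagonal_pair E Es.
Proof. by case. Qed.

Lemma tdp_revr Es E : tridiagonal_pair Es E -> tridiagonal_pair Es (rev_family E).
Proof. by move=> td; apply/tdp_sym/tdp_revl/tdp_sym. Qed.

Definition flag_meet Es E i j := (flag Es i :&: flag E j)%VS.

Definition flag_diag Es E a := (\sum_(k < D.+1) flag_meet Es E k%:Z (a - k%:Z))%VS.

(** Indices outside the summation range of [flag_diag] add nothing: the meet is zero for [i < 0],
    and for [i > D] the first flag is already full at [D]. *)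
Lemma flag_meet_diag Es E i j a : resolution Es -> resolution E -> i + j <= a ->
  (flag_meet Es E i j <= flag_diag Es E a)%VS.
Proof.
move=> resl resr ija; case: (ltP i 0) => [i0|i0].
  by rewrite /flag_meet (flag_lt0 resl) // cap0v sub0v.
case: (leP i D%:Z) => iD.
  have kD : (`|i|%N < D.+1)%N by lia.
  apply: subv_trans (sumv_sup (Ordinal kD) _ (subvv _)) => //=.
  by apply: capvS; apply: flag_sub => //; lia.
apply: subv_trans (sumv_sup ord_max _ (subvv _)) => //=.
apply: capvS; last by apply: flag_sub => //; lia.
by rewrite (flag_geD resl (lexx _)) subvf.
Qed.

Lemma flag_diag_sub Es E a a' : resolution Es -> resolution E -> a <= a' ->
  (flag_diag Es E a <= flag_diag Es E a')%VS.
Proof.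
by move=> resl resr aa; apply/subv_sumP => k _; apply: flag_meet_diag => //; lia.
Qed.

Lemma flag_diagC Es E a : resolution Es -> resolution E ->
  flag_diag Es E a = flag_diag E Es a.
Proof.
move=> resl resr; apply/eqP; rewrite eqEsubv; apply/andP.
by split; apply/subv_sumP => k _; rewrite /flag_meet capvC;
  apply: flag_meet_diag => //; lia.
Qed.

(* (A - theta_j) maps the meet of indices (i, j) into the meet of indices (i + 1, j - 1). *)
Lemma flag_diag_stable_half Es E a k : resolution Es -> resolution E ->
  tridiagonal_pair_half Es E -> stable (E k) (flag_diag Es E a).
Proof.
move=> resl resr [A [theta [tri eig gen]]]; apply: gen => {k}.
have eigl k : E k *m A = theta k *: E k.
  rewrite -[LHS]mulmx1 -(resolution_sum resr) mulmx_sumr (bigD1 k) //= big1 => [|l lk].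
    by rewrite -mulmxA eig -scalemxAr (resolution_mul resr) eqxx addr0.
  by rewrite -mulmxA eig -scalemxAr (resolution_mul resr) eq_sym (negPf lk) scaler0.
have raise i v : v \in flag Es i -> A *m v \in flag Es (i + 1).
  move=> /(mem_flagP resl) v0; apply/(mem_flagP resl) => k ik.
  rewrite (resolution_vec resl v) !mulmx_sumr big1 // => l _.
  case: (ltP i l%:Z) => il; first by rewrite v0 // !mulmx0.
  by rewrite !mulmxA tri ?mul0mx //; lia.
(* The default value of [inord] is harmless: the eigenvalue matters only when some [k] in 0..D
   equals [j]. *)
have lower j v : v \in flag E j -> A *m v - theta (inord `|j|%N) *: v \in flag E (j - 1).
  move=> /(mem_flagP resr) v0; apply/(mem_flagP resr) => k jk.
  rewrite mulmxBr mulmxA eigl -scalemxAr -scalemxAl -scalerBl.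
  case: (ltP j k%:Z) => jk'; first by rewrite v0 ?scaler0.
  have -> : inord `|j|%N = k by apply: val_inj; rewrite /= inordK; have := ltn_ord k; lia.
  by rewrite subrr scale0r.
move=> _ /memv_sumP[w wP ->]; rewrite mulmx_sumr; apply: memv_suml => k _.
have wk := wP k isT; have /memv_capP[wl wr] := wk.
rewrite -[A *m _](subrK (theta (inord `|a - k%:Z|%N) *: w k)).
apply: rpredD; last by apply: rpredZ; apply: (subvP (sumv_sup k _ (subvv _))).
apply: (subvP (@flag_meet_diag Es E (k%:Z + 1) (a - k%:Z - 1) a resl resr _)); first by lia.
apply/memv_capP; split; last exact: lower.
by apply: rpredB; [exact: raise | apply: rpredZ; apply: (subvP (flag_sub resl _)) wl; lia].
Qed.

Section Pair.
Variables Es E : 'I_D.+1 -> 'M[C]_n.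
Hypothesis td : tridiagonal_pair Es E.
Let resl := tdp_resl td.
Let resr := tdp_resr td.

Lemma flag_diag_stabler a k : stable (E k) (flag_diag Es E a).
Proof. exact: flag_diag_stable_half (tdp_halfl td). Qed.

Lemma flag_diag_stablel a k : stable (Es k) (flag_diag Es E a).
Proof. by rewrite flag_diagC //; apply: flag_diag_stable_half (tdp_halfr td). Qed.

(* In a sum of vectors from the meets of indices (k, i + j - 1 - k), the terms with k < i
   add up to a vector of the first flag at i - 1, the others to one of the second at j - 1. *)
Lemma flag_meet_cap_diag i j v :
  v \in flag_meet Es E i j -> v \in flag_diag Es E (i + j - 1) ->
  v \in (flag_meet Es E (i - 1) j + flag_meet Es E i (j - 1))%VS.
Proof.
move=> /memv_capP[vi vj] /memv_sumP[w wP vE].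
pose s := \sum_(k < D.+1 | k%:Z < i) w k.
have sl : s \in flag Es (i - 1).
  apply: memv_suml => k ki; have /memv_capP[wl _] := wP k isT.
  by apply: (subvP (flag_sub resl _)) wl; lia.
have tr : v - s \in flag E (j - 1).
  rewrite vE (bigID (fun k : 'I_D.+1 => k%:Z < i)) /= addrAC subrr add0r.
  apply: memv_suml => k ki; have /memv_capP[_ wr] := wP k isT.
  by apply: (subvP (flag_sub resr _)) wr; lia.
rewrite -(subrK s v) addrC memv_add //; apply/memv_capP; split=> //.
  rewrite -[s](subKr v); apply: rpredB => //.
  by apply: (subvP (flag_sub resr _)) tr; lia.
by apply: rpredB => //; apply: (subvP (flag_sub resl _)) sl; lia.
Qed.

(** By invariance, the projection [p] of [u] to the diagonal sum stays in both flags, hence lies in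
    the span of the two smaller meets. So [u] is orthogonal to [p], as is [u - p], and [p = 0]. *)
Lemma split_tilde_orth_diag i j u : split_tilde Es E down down i j u ->
  u \in orthv (flag_diag Es E (i + j - 1)).
Proof.
case=> /memv_capP[ui uj] utilde.
have [p pd upd] := orthv_decomp (flag_diag Es E (i + j - 1)) u.
have pi : p \in flag Es i.
  by apply: (flag_proj resl) pd upd => // k; apply: flag_diag_stablel.
have pj : p \in flag E j.
  by apply: (flag_proj resr) pd upd => // k; apply: flag_diag_stabler.
have up0 : hform u p = 0.
  by apply/utilde/flag_meet_cap_diag => //; apply/memv_capP.
have /hform_eq0 p0 : hform p p = 0.
  move: upd => /orthvP/(_ p pd); rewrite hformBl up0 sub0r => /eqP.
  by rewrite oppr_eq0 => /eqP.
by rewrite p0 subr0 in upd.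
Qed.

End Pair.

Lemma dim_flag_rev F U i : resolution F -> (forall k, stable (F k) U) ->
  (\dim U <= \dim (flag F i :&: U) + \dim (flag (rev_family F) (D%:Z - 1 - i) :&: U))%N.
Proof.
move=> resF FU; apply: leq_trans (dimv_add_leqif _ _); apply: dimvS.
apply/subvP => v vU; have [p pi [vpi pU]] := flag_split resF i v.
rewrite -(subrK p v) addrC memv_add //; apply/memv_capP; split=> //; first exact: pU.
by apply: rpredB => //; apply: pU.
Qed.

(** A vector of [U] in both flags lies in the diagonal sum and is orthogonal to it, hence is zero;
    the two intersections with [U] are therefore independent. *)
Lemma flag_meet_trivial Es E a i j U : tridiagonal_pair Es E -> i + j = a ->
  (U <= orthv (flag_diag Es E a))%VS ->
  (\dim (flag Es i :&: U) + \dim (flag E j :&: U) <= \dim U)%N.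
Proof.
move=> [resl resr _ _] ija Uorth.
rewrite -dimv_disjoint_sum; first by rewrite dimvS // subv_add !capvSr.
apply/eqP; rewrite -subv0; apply/subvP => v.
move=> /memv_capP[/memv_capP[vi vU] /memv_capP[vj _]].
have /orthvP/(_ v) := subvP Uorth _ vU.
rewrite (subvP (@flag_meet_diag _ _ i j a _ _ _)) ?ija ?memv_cap ?vi //.
by move=> /(_ isT)/hform_eq0->; rewrite mem0v.
Qed.

(* On a common invariant subspace U orthogonal to both sums, with s_i and t_j the dimensions
   of the intersections of U with the two flags, s_i + t_j <= dim U when i + j = a and
   s_i + t_j >= dim U when i + j = a - 1, so that s is nonincreasing from s_(-1) = 0. *)
Lemma orth_flag_diag_rev Es E a c : tridiagonal_pair Es E -> a + c = D%:Z + D%:Z - 1 ->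
  (orthv (flag_diag Es E a)
   :&: orthv (flag_diag (rev_family Es) (rev_family E) c) = 0)%VS.
Proof.
move=> td ac; have tdr := tdp_revl (tdp_revr td).
have [resl resr _ _] := td; have [resl' resr' _ _] := tdr.
set U := (_ :&: _)%VS.
have Ul : (U <= orthv (flag_diag Es E a))%VS by apply: capvSl.
have Ur : (U <= orthv (flag_diag (rev_family Es) (rev_family E) c))%VS by apply: capvSr.
have stabl k : stable (Es k) U.
  move=> v /memv_capP[vl vr]; apply/memv_capP; split.
    by apply: (orthv_stable resl) vl; apply: flag_diag_stablel.
  apply: (orthv_stable resl) vr; rewrite -(rev_ordK k).
  exact: (flag_diag_stablel tdr).
have stabr k : stable (E k) U.
  move=> v /memv_capP[vl vr]; apply/memv_capP; split.
    by apply: (orthv_stable resr) vl; apply: flag_diag_stabler.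
  apply: (orthv_stable resr) vr; rewrite -(rev_ordK k).
  exact: (flag_diag_stabler tdr).
(* The reversed indices complementary to [i] and [a - 1 - i] add up to [c]. Their upper bound, with
   the two splitting bounds, gives the lower bound for the pair of sum [a - 1]. *)
have decr i : (\dim (flag Es (i + 1) :&: U) <= \dim (flag Es i :&: U))%N.
  have := @flag_meet_trivial _ _ a (i + 1) (a - 1 - i) _ td _ Ul.
  have := @flag_meet_trivial _ _ c (D%:Z - 1 - i) (D%:Z - 1 - (a - 1 - i)) _ tdr _ Ur.
  have := dim_flag_rev i resl stabl; have := dim_flag_rev (a - 1 - i) resr stabr.
  move=> H1 H2 H3 H4.
  have {}H3 := H3 ltac:(lia); have {}H4 := H4 ltac:(lia).
  lia.
(* The shift by one starts the induction at index -1; [m = D + 1] reaches the full flag. *)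
have zero m : \dim (flag Es (m%:Z - 1) :&: U) = 0%N.
  elim: m => [|m IHm]; first by rewrite (flag_lt0 resl) // cap0v dimv0.
  have := decr (m%:Z - 1); rewrite IHm leqn0 => /eqP decr0.
  by rewrite -[RHS]decr0; congr (\dim (flag Es _ :&: U)%VS); lia.
have := zero D.+1; rewrite (flag_geD resl); last by lia.
by rewrite capfv => /eqP; rewrite dimv_eq0 => /eqP.
Qed.

Theorem split_tilde_dual Es E i j k l u v : tridiagonal_pair Es E ->
  split_tilde Es E down down i j u ->
  split_tilde (rev_family Es) (rev_family E) down down k l v ->
  hform u v <> 0 -> i + k = D%:Z /\ j + l = D%:Z.
Proof.
move=> td ut vt uv; have tdr := tdp_revl (tdp_revr td).
have [resl resr _ _] := td; have [resl' resr' _ _] := tdr.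
have uo := split_tilde_orth_diag td ut; have vo := split_tilde_orth_diag tdr vt.
case: ut vt => /memv_capP[ui uj] _ [/memv_capP[vk vl] _].
have ik : D%:Z <= i + k.
  by rewrite leNgt; apply/negP => ik; apply: uv; apply: (flag_orth resl) ui vk.
have jl : D%:Z <= j + l.
  by rewrite leNgt; apply/negP => jl; apply: uv; apply: (flag_orth resr) uj vl.
(* If the total is at most [2D], both inequalities are equalities. Otherwise [c <= k + l - 1], and
   [u] will be placed in the reversed diagonal sum at [c], to which [v] is orthogonal. *)
case: (ltP (D%:Z + D%:Z) (i + j + k + l)) => [big | ]; last by lia.
case: uv; set c := D%:Z + D%:Z - 1 - (i + j - 1).
have [g gc ugc] := orthv_decomp (flag_diag (rev_family Es) (rev_family E) c) u.
(* The levels [i + j - 1] and [c] add up to [2D - 1], so for any two summands one of the two pairs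
   of flag indices adds up to less than [D]. *)
have go : g \in orthv (flag_diag Es E (i + j - 1)).
  apply/orthvP => w /memv_sumP[y yP ->]; rewrite hform_sumr big1 // => h _.
  have /memv_capP[yl yr] := yP h isT.
  have /memv_sumP[z zP ->] := gc; rewrite hformC hform_sumr big1 ?conjC0 // => m _.
  have /memv_capP[zl zr] := zP m isT.
  case: (ltP (h%:Z + m%:Z) D%:Z) => hm; first exact: (flag_orth resl) hm yl zl.
  by apply: (flag_orth resr) yr zr; rewrite /c; lia.
have : u - g \in (orthv (flag_diag Es E (i + j - 1))
   :&: orthv (flag_diag (rev_family Es) (rev_family E) c))%VS.
  by apply/memv_capP; split=> //; apply: rpredB.
rewrite orth_flag_diag_rev; [rewrite memv0 subr_eq0 => /eqP-> | done | by rewrite /c; lia].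
rewrite hformC; move/orthvP: vo => ->; rewrite ?conjC0 //.
by apply: (subvP (flag_diag_sub resl' resr' _)) gc; rewrite /c; lia.
Qed.

(** * Arbitrary orientations and comparison of eigenvalues *)

Definition opposite mu := if mu is down then up else down.

Definition orient mu F := if mu is down then F else rev_family F.

Lemma partial_sumE mu F i : partial_sum mu F i = flag (orient mu F) i.
Proof. by case: mu => //; apply: partial_sum_up. Qed.

Lemma orient_opposite mu F : orient (opposite mu) F =1 rev_family (orient mu F).
Proof. by case: mu => k //=; rewrite rev_familyK. Qed.

Lemma split_spaceE Es E mu nu i j :
  split_space Es E mu nu i j = flag_meet (orient mu Es) (orient nu E) i j.
Proof. by rewrite /split_space !partial_sumE. Qed.

Lemma split_space_opposite Es E mu nu i j :
  split_space Es E (opposite mu) (opposite nu) i j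
  = split_space (rev_family (orient mu Es)) (rev_family (orient nu E)) down down i j.
Proof.
by rewrite /split_space !partial_sumE /=; congr (_ :&: _)%VS;
  apply: eq_flag; apply: orient_opposite.
Qed.

Lemma tdp_orient Es E mu nu : tridiagonal_pair Es E ->
  tridiagonal_pair (orient mu Es) (orient nu E).
Proof.
move=> td; case: mu; case: nu => //=; first exact: tdp_revr.
  exact: tdp_revl.
by apply/tdp_revr/tdp_revl.
Qed.

Corollary split_tilde_opposite Es E mu nu i j k l u v : tridiagonal_pair Es E ->
  split_tilde Es E mu nu i j u ->
  split_tilde Es E (opposite mu) (opposite nu) k l v ->
  hform u v <> 0 -> i + k = D%:Z /\ j + l = D%:Z.
Proof.
move=> /(tdp_orient mu nu) td ut vt; apply: split_tilde_dual td _ _.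
  by move: ut; rewrite /split_tilde !split_spaceE.
by move: vt; rewrite /split_tilde !split_space_opposite.
Qed.

(** The flags are real. This passes from [hform] to the bilinear pairing [u^T *m v], in which
    transposes are computed. *)
Lemma split_tilde_conj Es E mu nu i j v : tridiagonal_pair Es E ->
  split_tilde Es E mu nu i j v ->
  split_tilde Es E mu nu i j (map_mx Num.conj v).
Proof.
move=> /(tdp_orient mu nu)[resl resr _ _]; rewrite /split_tilde !split_spaceE.
have meet_conj i' j' w : w \in flag_meet (orient mu Es) (orient nu E) i' j' ->
  map_mx Num.conj w \in flag_meet (orient mu Es) (orient nu E) i' j'.
  move=> /memv_capP[wl wr]; apply/memv_capP.
  by split; [apply: (flag_conj resl) | apply: (flag_conj resr)].
case=> vij vo; split=> [|w /memv_addP[w1 w1P [w2 w2P ->]]]; first exact: meet_conj.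
rewrite hform_conj vo ?conjC0 // map_mxD.
by apply: memv_add; apply: meet_conj.
Qed.

(** The split components span: a vector of the meet (i, j) minus its projection to the two smaller
    meets is in the split component, and the projection is handled by induction on [i + j]. *)
Lemma split_tilde_ind Es E mu nu (P : 'cV[C]_n -> Prop) : tridiagonal_pair Es E ->
  P 0 -> (forall u v, P u -> P v -> P (u + v)) ->
  (forall (i j : 'I_D.+1) v, split_tilde Es E mu nu i j v -> P v) -> forall v, P v.
Proof.
move=> /(tdp_orient mu nu)[resl resr _ _] P0 PD Pt.
(* The bound [m - 1] makes the base case [i + j < -1], where one index is negative and the meet is
   zero. *)
have step m : forall i j : int, i <= D%:Z -> j <= D%:Z -> i + j < m%:Z - 1 ->
    forall v, v \in split_space Es E mu nu i j -> P v.
  elim: m => [|m IHm] i j iD jD ijm v; rewrite split_spaceE.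
    have [i0|i0] := ltP i 0.
      by rewrite /flag_meet (flag_lt0 resl) // cap0v memv0 => /eqP->.
    by rewrite /flag_meet (flag_lt0 resr) ?capv0 ?memv0 => [/eqP->|]; last lia.
  have [i0|i0] := ltP i 0.
    by rewrite /flag_meet (flag_lt0 resl) // cap0v memv0 => /eqP->.
  have [j0|j0] := ltP j 0.
    by rewrite /flag_meet (flag_lt0 resr) // capv0 memv0 => /eqP->.
  rewrite -split_spaceE => vij.
  set W := (split_space Es E mu nu (i - 1) j + split_space Es E mu nu i (j - 1))%VS.
  have WV : (W <= split_space Es E mu nu i j)%VS.
    rewrite subv_add !split_spaceE.
    by apply/andP; split; apply: capvS; apply: flag_sub => //; lia.
  have [p pW vp] := orthv_decomp W v.
  rewrite -(subrK p v); apply: (PD).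
    have iD' : (`|i|%N < D.+1)%N by lia.
    have jD' : (`|j|%N < D.+1)%N by lia.
    apply: (Pt (Ordinal iD') (Ordinal jD')); rewrite /= !gez0_abs //.
    split; last by apply/orthvP.
    by apply: rpredB => //; apply: (subvP WV).
  have /memv_addP[p1 p1P [p2 p2P ->]] := pW.
  apply: (PD); first by apply: IHm p1P; lia.
  by apply: IHm p2P; lia.
move=> v; apply: (step (D + D).+2 D%:Z D%:Z) => //; first by lia.
by rewrite split_spaceE /flag_meet (flag_geD resl) // (flag_geD resr) // capfv memvf.
Qed.

Lemma mulmx_sandwich_eq (M N : 'M[C]_n) :
  (forall u v : 'cV[C]_n, u^T *m M *m v = u^T *m N *m v) -> M = N.
Proof.
move=> MN; apply/matrixP => k l.
have := MN (delta_mx k 0) (delta_mx l 0).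
by rewrite !trmx_delta -!rowE -!colE => /matrixP/(_ 0 0); rewrite !mxE.
Qed.

(** Both opposite families of split components span, so testing on them suffices; a nonzero pairing
    forces complementary indices. *)
Lemma split_sandwich_eq Es E mu nu (M N : 'M[C]_n) : tridiagonal_pair Es E ->
  (forall (i j k l : 'I_D.+1) u v,
    split_tilde Es E mu nu i j u ->
    split_tilde Es E (opposite mu) (opposite nu) k l v ->
    u^T *m v != 0 -> i%:Z + k%:Z = D%:Z -> j%:Z + l%:Z = D%:Z ->
    u^T *m M *m v = u^T *m N *m v) ->
  (forall (i j k l : 'I_D.+1) u v,
    split_tilde Es E mu nu i j u ->
    split_tilde Es E (opposite mu) (opposite nu) k l v ->
    u^T *m v = 0 -> u^T *m M *m v = u^T *m N *m v) ->
  M = N.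
Proof.
move=> td dual orth; apply: mulmx_sandwich_eq => u v; move: u.
apply: (@split_tilde_ind _ _ mu nu _ td) => [|u1 u2 H1 H2|i j u ut].
- by rewrite trmx0 !mul0mx.
- by rewrite linearD /= !mulmxDl H1 H2.
move: v; apply: (@split_tilde_ind _ _ (opposite mu) (opposite nu) _ td) => [|v1 v2 H1 H2|k l v vt].
- by rewrite !mulmx0.
- by rewrite !mulmxDr H1 H2.
have [uv0|uv0] := eqVneq (u^T *m v) 0; first exact: (orth _ _ _ _ _ _ ut vt).
have [|ik jl] := split_tilde_opposite td ut (split_tilde_conj td vt).
  have -> : hform u (map_mx Num.conj v) = (u^T *m v) 0 0.
    by rewrite hformE mxE; apply: eq_bigr => r _; rewrite !mxE conjCK.
  move=> uv.
  by case/eqP: uv0; apply/matrixP => r s; rewrite !ord1 uv mxE.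
exact: (dual _ _ _ _ _ _ ut vt).
Qed.

Theorem split_operators_transpose Es E (q : C) (B Bs K Ks : 'M[C]_n) :
  tridiagonal_pair Es E -> q != 0 ->
  acts_on_split Es E down up (fun i j => q ^ (i - j)) B ->
  acts_on_split Es E up down (fun i j => q ^ (j - i)) Bs ->
  acts_on_split Es E down down (fun i j => q ^ (i - j)) K ->
  acts_on_split Es E up up (fun i j => q ^ (i - j)) Ks ->
  [/\ B^T = Bs, Ks \in unitmx & K^T = invmx Ks].
Proof.
move=> td q0 actB actBs actK actKs.
(* The eigenvalues multiply to [q ^ ((i + k) - (j + l))], which is 1 at complementary indices. *)
have KKs : K^T *m Ks = 1%:M.
  apply: (split_sandwich_eq (mu := down) (nu := down) td) => i j k l u v ut vt uv.
    move=> ik jl; rewrite mulmx1 !mulmxA -trmx_mul (actK _ _ _ ut) -mulmxA (actKs _ _ _ vt).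
    rewrite -scalemxAr linearZ /= -scalemxAl scalerA -expfzDr //.
    by rewrite (_ : _ + _ = 0) ?expr0z ?scale1r //; lia.
  rewrite mulmx1 !mulmxA -trmx_mul (actK _ _ _ ut) -mulmxA (actKs _ _ _ vt).
  by rewrite -scalemxAr linearZ /= -scalemxAl uv !scaler0.
have [_ Ks_unit] := mulmx1_unit KKs.
split=> //; last by rewrite -[LHS](mulmxK Ks_unit) KKs mul1mx.
(* Here complementary indices give [i - j = l - k], so the two eigenvalues agree. *)
apply: (split_sandwich_eq (mu := down) (nu := up) td) => i j k l u v ut vt uv.
  move=> ik jl; rewrite -trmx_mul (actB _ _ _ ut) -mulmxA (actBs _ _ _ vt).
  rewrite -scalemxAr linearZ /= -scalemxAl.
  by rewrite (_ : i%:Z - j%:Z = l%:Z - k%:Z) //; lia.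
rewrite -trmx_mul (actB _ _ _ ut) -mulmxA (actBs _ _ _ vt).
by rewrite -scalemxAr linearZ /= -scalemxAl uv !scaler0.
Qed.

End Displacement.

(** * Distances and intersection numbers *)

Section GraphDistance.
Variables (X : finType) (e : rel X).
Hypothesis conn : connected_simple_graph e.
Implicit Types x y z : X.

(** A path without repeated vertices has fewer than [#|X|] edges, so the search in [dist] succeeds
    within its range. *)
Lemma dist_path x y : exists p, [/\ path e x p, last x p = y & size p = dist e x y].
Proof.
have [_ _ /(_ x y)/connectP[p0 p0P ->]] := conn.
case/shortenP: p0P => p pP p_uniq _ {p0}.
set s := fun n => [exists t : n.-tuple X, path e x t && (last x t == last x p)].
have has_s : has s (iota 0 #|X|).
  apply/hasP; exists (size p).
    by rewrite mem_iota add0n -[(size p).+1]/(size (x :: p)) -(card_uniqP p_uniq) max_card.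
  by apply/existsP; exists (in_tuple p); rewrite pP eqxx.
have := nth_find 0%N has_s; rewrite nth_iota; last first.
  by move: has_s; rewrite has_find size_iota.
rewrite add0n => /existsP[t /andP[tP /eqP tl]]; exists t; split=> //.
by rewrite size_tuple.
Qed.

Lemma dist_leq_size x p : path e x p -> (dist e x (last x p) <= size p)%N.
Proof.
move=> pP; rewrite leqNgt; apply/negP => lt_p.
have := before_find 0%N lt_p; rewrite nth_iota; last first.
  by apply: leq_trans lt_p _; rewrite -[X in (_ <= X)%N](size_iota 0) find_size.
by rewrite add0n => /negbT/existsP; apply; exists (in_tuple p); rewrite /= pP eqxx.
Qed.

Lemma dist_triangle x y z : (dist e x z <= dist e x y + dist e y z)%N.
Proof.
have [p [pP <- <-]] := dist_path x y; have [r [rP <- <-]] := dist_path (last x p) z.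
by rewrite -size_cat -last_cat dist_leq_size // cat_path pP.
Qed.

Lemma dist_sym_leq x y : (dist e y x <= dist e x y)%N.
Proof.
have [p [pP <- <-]] := dist_path x y; have [e_sym _ _] := conn.
have rP : path e (last x p) (rev (belast x p)).
  by rewrite rev_path; rewrite (eq_path (e' := e)) // => a c; apply: e_sym.
have -> : size p = size (rev (belast x p)) by rewrite size_rev size_belast.
have xE : x = last (last x p) (rev (belast x p)).
  by case: (p) => //= a r; rewrite rev_cons last_rcons.
by rewrite {2}xE dist_leq_size.
Qed.

Lemma dist_sym x y : dist e x y = dist e y x.
Proof. by apply/eqP; rewrite eqn_leq !dist_sym_leq. Qed.

Lemma dist_eq0 x y : (dist e x y == 0%N) = (x == y).
Proof.
apply/eqP/eqP => [d0|->]; last by apply/eqP; rewrite -leqn0; apply: (@dist_leq_size y [::]).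
by have [p [_ pl]] := dist_path x y; rewrite d0 => /size0nil p0; rewrite -pl p0.
Qed.

Lemma dist_eq1 x y : (dist e x y == 1%N) = e x y.
Proof.
apply/eqP/idP => [d1|xy].
  have [p [pP pl]] := dist_path x y; rewrite d1 => p1; rewrite -pl.
  by case: p p1 pP {pl} => [|z [|]] //= _ /andP[].
apply/eqP; rewrite eqn_leq lt0n dist_eq0 (@dist_leq_size x [:: y]) /= ?xy //.
by apply/eqP => xE; have [_ /(_ x) + _] := conn; rewrite {2}xE xy.
Qed.

Lemma dist_step x y k : dist e x y = k.+1 ->
  exists z, dist e x z = 1%N /\ dist e z y = k.
Proof.
move=> dk; have [[|z p] [pP pl ps]] := dist_path x y; first by rewrite -ps in dk.
move: pP => /= /andP[xz pP]; exists z; have /eqP xz1 := xz; rewrite -dist_eq1 in xz.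
move/eqP: xz => {}xz1; split=> //.
have zy := dist_leq_size pP; rewrite /= in pl; rewrite pl in zy.
have := dist_triangle x z y; rewrite /= in ps; lia.
Qed.

Lemma dist_leq_diameter x y : (dist e x y <= diameter e)%N.
Proof.
apply: leq_trans (bigop.leq_bigmax (F := fun x => \max_y dist e x y)%N x).
exact: (bigop.leq_bigmax (F := fun y => dist e x y) y).
Qed.

Lemma dist_attained h x0 : (h <= diameter e)%N -> exists x y, dist e x y = h.
Proof.
move=> hD; have [x [y xyD]] : exists x y, dist e x y = diameter e.
  have X0 : (0 < #|X|)%N by apply/card_gt0P; exists x0.
  have [x xE] := bigop.eq_bigmax (fun x => \max_y dist e x y)%N X0.
  have [y yE] := bigop.eq_bigmax (fun y => dist e x y) X0.
  by exists x, y; rewrite /diameter xE yE.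
(* Walking along a geodesic lowers the distance by one; at distance 0 the truncated subtraction
   stays at 0. *)
have down m : exists x y, dist e x y = (diameter e - m)%N.
  elim: m => [|m [x1 [y1 xy1]]]; first by exists x, y; rewrite subn0.
  case E : (diameter e - m)%N xy1 => [|k] xy1.
    by exists x1, y1; rewrite xy1; lia.
  by have [z [_ zy]] := dist_step xy1; exists z, y1; rewrite zy; lia.
by have := down (diameter e - h)%N; rewrite subKn.
Qed.

Lemma sphere_meet0 x y i j : (0 < sphere_meet e x y i j)%N ->
  exists z, dist e x z = i /\ dist e z y = j.
Proof. by case/card_gt0P => z; rewrite inE => /andP[/eqP <- /eqP <-]; exists z. Qed.

Lemma inter_num_far h i j : (0 < inter_num e h i j)%N ->
  [/\ (h <= i + j)%N, (j <= h + i)%N & (i <= h + j)%N].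
Proof.
rewrite /inter_num; case: pickP => // -[x y] /= /eqP <- /sphere_meet0[z [<- <-]].
have := dist_triangle x z y; have := dist_triangle z x y; have := dist_triangle x y z.
by rewrite (dist_sym z x) (dist_sym y z); split; lia.
Qed.

Section DistanceRegular.
Hypothesis dreg : distance_regular e.

Lemma inter_num_neigh k x0 : (k < diameter e)%N -> (0 < inter_num e k.+1 1 k)%N.
Proof.
move=> kD; have [x [y xy]] := dist_attained x0 kD.
have [z [xz zy]] := dist_step xy.
by rewrite -xy -dreg; apply/card_gt0P; exists z; rewrite inE xz zy !eqxx.
Qed.

Lemma inter_num0 h j x0 : (h <= diameter e)%N -> inter_num e h 0 j = (h == j).
Proof.
move=> hD; have [x [y xy]] := dist_attained x0 hD; rewrite -xy -dreg /sphere_meet.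
have -> : [set z | (dist e x z == 0) && (dist e z y == j)]%N
          = if dist e x y == j then [set x] else set0.
  apply/setP => z; rewrite inE dist_eq0; case: (eqVneq x z) => [<-|xz] /=.
    by case: eqP; rewrite ?inE ?eqxx.
  by case: eqP; rewrite !inE // eq_sym (negPf xz).
by case: eqP; rewrite ?cards1 ?cards0.
Qed.

End DistanceRegular.
End GraphDistance.

(** * The Bose-Mesner algebra and its dual *)

(** The trace is the sum of the squared moduli of the entries. *)
Lemma mxtrace_gram_eq0 (C : numClosedFieldType) (m n : nat) (M : 'M[C]_(m, n)) :
  \tr (M *m (map_mx Num.conj M)^T) = 0 -> M = 0.
Proof.
have entry y : (M *m (map_mx Num.conj M)^T) y y = \sum_z M y z * (M y z)^*.
  by rewrite mxE; apply: eq_bigr => z _; rewrite !mxE.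
have entry_ge0 y : 0 <= (M *m (map_mx Num.conj M)^T) y y.
  by rewrite entry sumr_ge0 // => z _; apply: mul_conjC_ge0.
move=> /eqP; rewrite psumr_eq0 // => /allP M0; apply/matrixP => y z.
have := M0 y (mem_index_enum _); rewrite /= entry psumr_eq0 => [/allP|a _]; last first.
  exact: mul_conjC_ge0.
by move/(_ z (mem_index_enum _)); rewrite /= mul_conjC_eq0 mxE => /eqP.
Qed.

Section BoseMesner.
Variables (C : numClosedFieldType) (X : finType) (e : rel X) (x : X) (D : nat).
Hypotheses (conn : connected_simple_graph e) (dreg : distance_regular e).
Hypotheses (diamD : diameter e = D) (D_gt0 : (0 < D)%N).
Implicit Types M P Q : 'M[C]_#|X|.

Local Notation BM := (bose_mesner C e).
Local Notation A := (distance_matrix C e).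
Local Notation N := (#|X|%:R : C).

Lemma order_neq0 : N != 0.
Proof. by rewrite pnatr_eq0 -lt0n; apply/card_gt0P; exists x. Qed.

Lemma distance_matrix_bm (k : 'I_D.+1) : A k \in BM.
Proof.
have kD : (k < (diameter e).+1)%N by rewrite diamD.
by apply: (subvP (sumv_sup (Ordinal kD) _ (subvv _))); rewrite ?memv_line.
Qed.

Lemma bmP M : M \in BM -> exists c : 'I_D.+1 -> C, M = \sum_k c k *: A k.
Proof.
rewrite /bose_mesner diamD => /memv_sumP[w wP ->].
have cP k : exists c, w k = c *: A k by apply/vlineP/wP.
have [c cE] := fin_all_exists cP.
by exists c; apply: eq_bigr.
Qed.

Lemma distance_matrix_tr k : (A k)^T = A k.
Proof. by apply/matrixP => y z; rewrite !mxE dist_sym. Qed.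

Lemma distance_matrix_conj k : map_mx Num.conj (A k) = A k.
Proof. by apply/matrixP => y z; rewrite !mxE conjC_nat. Qed.

Lemma distance_matrix0 : A 0 = 1%:M.
Proof.
by apply/matrixP => y z; rewrite !mxE dist_eq0 // (inj_eq enum_val_inj).
Qed.

Lemma sum_dist_eq y z (f : 'I_D.+1 -> C) :
  exists2 k : 'I_D.+1, dist e y z = k & \sum_h f h * (dist e y z == h)%:R = f k.
Proof.
have dD : (dist e y z < D.+1)%N by rewrite -diamD ltnS dist_leq_diameter.
exists (Ordinal dD) => //; rewrite (bigD1 (Ordinal dD)) //= eqxx mulr1 big1 ?addr0 //.
by move=> h hd; rewrite -[dist e y z]/(nat_of_ord (Ordinal dD)) val_eqE eq_sym (negPf hd) mulr0.
Qed.

Lemma distance_matrix_sum : \sum_(k < D.+1) A k = const_mx 1.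
Proof.
apply/matrixP => y z; rewrite summxE !mxE.
have [k _ <-] := sum_dist_eq (enum_val y) (enum_val z) (fun _ => 1).
by apply: eq_bigr => h _; rewrite mxE mul1r.
Qed.

Lemma distance_matrix_mul i j :
  A i *m A j = \sum_(h < D.+1) (inter_num e h i j)%:R *: A h.
Proof.
apply/matrixP => y z; rewrite summxE !mxE.
have [k dk sumE] :=
  sum_dist_eq (enum_val y) (enum_val z) (fun h => (inter_num e h i j)%:R).
transitivity ((inter_num e k i j)%:R : C); last first.
  by rewrite -sumE; apply: eq_bigr => h _; rewrite !mxE.
rewrite -dk -dreg /sphere_meet -sum1_card natr_sum (reindex _ (onW_bij _ (enum_val_bij X))) /=.
rewrite [RHS]big_mkcond /=; apply: eq_bigr => w _; rewrite !mxE inE.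
by case: eqP; case: eqP; rewrite ?mulr1 ?mulr0 ?mul0r.
Qed.

Lemma bm_tr M : M \in BM -> M^T = M.
Proof.
case/bmP => c ->; rewrite linear_sum; apply: eq_bigr => k _.
by rewrite linearZ /= distance_matrix_tr.
Qed.

Lemma bm_conj M : M \in BM -> map_mx Num.conj M \in BM.
Proof.
case/bmP => c ->; rewrite map_mx_sum; apply: memv_suml => k _.
by rewrite map_mxZ distance_matrix_conj rpredZ // distance_matrix_bm.
Qed.

Lemma bm_mul P Q : P \in BM -> Q \in BM -> P *m Q \in BM.
Proof.
move=> /bmP[c ->] /bmP[d ->]; rewrite mulmx_suml; apply: memv_suml => i _.
rewrite mulmx_sumr; apply: memv_suml => j _.
rewrite -scalemxAl -scalemxAr distance_matrix_mul !rpredZ //.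
by apply: memv_suml => h _; rewrite rpredZ // distance_matrix_bm.
Qed.

(** The algebra is closed under products and consists of symmetric matrices. *)
Lemma bm_comm P Q : P \in BM -> Q \in BM -> P *m Q = Q *m P.
Proof.
by move=> PB QB; rewrite -(bm_tr (bm_mul PB QB)) trmx_mul !bm_tr.
Qed.

(** [P = P *m Q + (P - P *m Q)] is a sum of orthogonal idempotents, one of which vanishes by
    primitivity. *)
Lemma primitive_idempotent_mul P Q :
  primitive_idempotent e P -> primitive_idempotent e Q ->
  P *m Q = 0 \/ P *m Q = P.
Proof.
move=> [[PB PP] _ Pprim] [[QB QQ] _ _].
have PQc := bm_comm PB QB; have PQB := bm_mul PB QB.
have PQ2 : P *m Q *m (P *m Q) = P *m Q.
  by rewrite {2}PQc mulmxA -(mulmxA P) QQ -mulmxA -PQc mulmxA PP.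
have PPQ : P *m (P *m Q) = P *m Q by rewrite mulmxA PP.
have PQP : P *m Q *m P = P *m Q by rewrite -(bm_comm PB PQB).
have [] := Pprim (P *m Q) (P - P *m Q).
- by [].
- by split; [apply: rpredB | rewrite mulmxBl !mulmxBr PP PPQ PQP PQ2 subrr subr0].
- by rewrite mulmxBr PQP PQ2 subrr.
- by rewrite mulmxBl PPQ PQ2 subrr.
- by rewrite addrC subrK.
- by left.
by move=> /eqP; rewrite subr_eq0 => /eqP <-; right.
Qed.

(* On both sides the coefficients are the intersection numbers p^h_{1k}, and
   p^(k+1)_{1k} != 0 lets P_(k+1) be recovered from P_1 P_k. *)
Lemma three_term_stable n (F : 'I_D.+1 -> 'M[C]_n) (U : {vspace 'cV[C]_n}) :
  F ord0 = 1%:M ->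
  (forall k : 'I_D.+1, F (inord 1) *m F k = \sum_(h < D.+1) (inter_num e h 1 k)%:R *: F h) ->
  stable (F (inord 1)) U -> forall k, stable (F k) U.
Proof.
move=> F0 rec F1U.
suff main m : forall k : 'I_D.+1, (k <= m)%N -> stable (F k) U by move=> k; apply: (main k).
elim: m => [|m IHm] k.
  by rewrite leqn0 => k0 u uU; rewrite (_ : k = ord0) ?F0 ?mul1mx //; apply/val_inj/eqP.
rewrite leq_eqVlt => /orP[/eqP km|]; last by rewrite ltnS; apply: IHm.
move=> u uU; have mD : (m < D.+1)%N by have := ltn_ord k; lia.
have IH : stable (F (Ordinal mD)) U by apply: IHm.
have := F1U _ (IH u uU); rewrite mulmxA rec mulmx_suml (bigD1 k) //= => FU.
have restU : \sum_(h < D.+1 | h != k) (inter_num e h 1 m)%:R *: F h *m u \in U.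
  apply: memv_suml => h hk; rewrite -scalemxAl.
  case: (posnP (inter_num e h 1 m)) => [->|/(inter_num_far conn)[hm _ _]].
    by rewrite scale0r mem0v.
  apply/rpredZ/IHm => //.
  by move: hk; rewrite -val_eqE /= km; lia.
have := rpredB FU restU; rewrite addrK -scalemxAl => cU.
have c0 : (inter_num e k 1 m)%:R != 0 :> C.
  rewrite pnatr_eq0 -lt0n km; apply: inter_num_neigh => //.
  by rewrite diamD; have := ltn_ord k; lia.
by have := rpredZ (inter_num e k 1 m)%:R^-1 cU; rewrite scalerA mulVf // scale1r.
Qed.

(** * Primitive idempotents as a real resolution of the identity *)

Section Idempotents.
Variable E : 'I_D.+1 -> 'M[C]_#|X|.
Hypothesis primE : primitive_idempotents e E.

Lemma idempotent_prim k : primitive_idempotent e (E k).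
Proof. by case: primE => _ ->; exists k. Qed.

Lemma idempotent_bm k : E k \in BM.
Proof. by case: (idempotent_prim k) => -[]. Qed.

Lemma idempotent_mul k l : E k *m E l = if k == l then E k else 0.
Proof.
case: eqVneq => [<-|kl]; first by case: (idempotent_prim k) => -[].
have [//|kk] := primitive_idempotent_mul (idempotent_prim k) (idempotent_prim l).
have [|ll] := primitive_idempotent_mul (idempotent_prim l) (idempotent_prim k).
  by rewrite (bm_comm (idempotent_bm l)) // idempotent_bm.
case/eqP: kl; case: primE => injE _; apply: injE.
by rewrite -kk -[RHS]ll (bm_comm (idempotent_bm l)) // idempotent_bm.
Qed.

(** The [D + 1] orthogonal nonzero idempotents are independent in a space spanned by [D + 1]
    distance matrices. *)
Lemma bm_spanP M : M \in BM -> exists c : 'I_D.+1 -> C, M = \sum_k c k *: E k.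
Proof.
pose s := [tuple E k | k < D.+1].
have sE (k : 'I_D.+1) : s`_k = E k by rewrite -tnth_nth tnth_mktuple.
have free_s : free s.
  apply/freeP => c c0 k; have := congr1 (mulmx (E k)) c0.
  rewrite mulmx0 mulmx_sumr (bigD1 k) //= big1 ?addr0 => [|l lk].
    rewrite sE -scalemxAr idempotent_mul eqxx => /eqP; rewrite scaler_eq0.
    by case: (idempotent_prim k) => _ /negPf-> _; rewrite orbF => /eqP.
  by rewrite sE -scalemxAr idempotent_mul eq_sym (negPf lk) scaler0.
have spanE : <<s>>%VS = BM.
  apply/eqP; rewrite eqEdim; apply/andP; split.
    by apply/span_subvP => _ /mapP[k _ ->]; apply: idempotent_bm.
  move: free_s; rewrite /free size_tuple => /eqP ->.
  rewrite /bose_mesner diamD; apply: leq_trans (dimv_leq_sum _ _ _) _.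
  apply: leq_trans (_ : \sum_(k < D.+1) 1 <= _)%N.
    by apply: leq_sum => k _; rewrite dim_vline leq_b1.
  by rewrite sum1_card card_ord.
rewrite -spanE => /coord_span ->; exists (fun k => coord s k M).
by apply: eq_bigr => k _; rewrite sE.
Qed.

Lemma sum_scale_mul (c : 'I_D.+1 -> C) k :
  (\sum_l c l *: E l) *m E k = c k *: E k.
Proof.
rewrite mulmx_suml (bigD1 k) //= -scalemxAl idempotent_mul eqxx big1 ?addr0 // => l lk.
by rewrite -scalemxAl idempotent_mul (negPf lk) scaler0.
Qed.

(* conj(E_k) E_k = c E_k for a scalar c with c^2 = c, and c != 0 since E_k is symmetric, so
   that the trace of E_k conj(E_k) is a sum of squared moduli. *)
Lemma idempotent_conj k : map_mx Num.conj (E k) = E k.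
Proof.
have EB := idempotent_bm k; have cEB := bm_conj EB.
have [c cE] := bm_spanP cEB.
have cEE : map_mx Num.conj (E k) *m E k = c k *: E k by rewrite cE sum_scale_mul.
have E2 : E k *m E k = E k by rewrite idempotent_mul eqxx.
have E0 : E k != 0 by case: (idempotent_prim k).
have ck0 : c k != 0.
  apply: contra E0 => /eqP c0; apply/eqP/mxtrace_gram_eq0.
  by rewrite (bm_tr cEB) -(bm_comm cEB EB) cEE c0 scale0r mxtrace0.
have ck1 : c k = 1.
  have : map_mx Num.conj (E k) *m E k *m (map_mx Num.conj (E k) *m E k)
         = map_mx Num.conj (E k) *m E k.
    rewrite mulmxA -(mulmxA (map_mx Num.conj (E k)) (E k)) -(bm_comm cEB EB) mulmxA.
    by rewrite -map_mxM E2 -mulmxA E2.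
  rewrite cEE -scalemxAl -scalemxAr E2.
  rewrite scalerA => /eqP; rewrite -subr_eq0 -scalerBl scaler_eq0 (negPf E0) orbF.
  by rewrite subr_eq0 -[X in _ == X]mulr1 (inj_eq (mulfI ck0)) => /eqP.
move: cEE; rewrite ck1 scale1r => cEE.
have EcE : map_mx Num.conj (map_mx Num.conj (E k)) = E k.
  by apply/matrixP => y z; rewrite !mxE conjCK.
have := congr1 (map_mx Num.conj) cEE; rewrite map_mxM EcE => EE.
by rewrite -[LHS]EE -(bm_comm cEB EB).
Qed.

Lemma idempotent_sum : \sum_k E k = 1%:M.
Proof.
have [c cE] : exists c : 'I_D.+1 -> C, 1%:M = \sum_k c k *: E k.
  by apply: bm_spanP; rewrite -distance_matrix0 (distance_matrix_bm ord0).
rewrite cE; apply: eq_bigr => k _.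
by rewrite -(sum_scale_mul c) -cE mul1mx.
Qed.

Lemma idempotent_resolution : resolution E.
Proof.
split; first exact: idempotent_sum.
- exact: idempotent_mul.
- by move=> k; apply/bm_tr/idempotent_bm.
- exact: idempotent_conj.
Qed.

Lemma dual_idempotent_resolution :
  resolution (fun k : 'I_D.+1 => dual_idempotent C e x k).
Proof.
split=> [|k l|k|k]; rewrite /dual_idempotent.
- apply/matrixP => y z; rewrite summxE !mxE; case: (eqVneq y z) => [->|yz]; last first.
    by apply: big1 => k _; rewrite !mxE (negPf yz) mulr0n.
  have [k _ sum1] := sum_dist_eq x (enum_val z) (fun _ => 1); rewrite -[RHS]sum1.
  by apply: eq_bigr => h _; rewrite !mxE eqxx mulr1n mul1r.
- rewrite mulmx_diag; case: eqVneq => [<-|kl].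
    by congr diag_mx; apply/rowP => y; rewrite !mxE -natrM mulnb andbb.
  apply/matrixP => y z; rewrite !mxE -natrM mulnb.
  case: eqP => [->|_] /=; last by rewrite mul0rn.
  by rewrite (inj_eq val_inj) (negPf kl) mul0rn.
- exact: tr_diag_mx.
- by apply/matrixP => y z; rewrite !mxE rmorphMn /= conjC_nat.
Qed.

(** The adjacency matrix [A 1] serves: it is tridiagonal by the triangle inequality, and its
    recurrence yields all distance matrices, hence all [E k]. *)
Lemma tridiagonal_pair_half_graph :
  tridiagonal_pair_half (fun k : 'I_D.+1 => dual_idempotent C e x k) E.
Proof.
have one : val (inord 1 : 'I_D.+1) = 1%N by rewrite /= inordK.
have [theta thetaE] := bm_spanP (distance_matrix_bm (inord 1)).
exists (A 1), theta; split=> [k l kl|k|U U1 k].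
- rewrite mul_diag_mx mul_mx_diag; apply/matrixP => y z; rewrite !mxE -!natrM !mulnb.
  apply/eqP; rewrite pnatr_eq0 eqb0; apply/negP => /andP[/andP[/eqP xy /eqP yz] /eqP xz].
  have := dist_triangle conn x (enum_val y) (enum_val z).
  have := dist_triangle conn x (enum_val z) (enum_val y).
  by rewrite (dist_sym conn (enum_val z)) xy yz xz; lia.
- by rewrite -one thetaE sum_scale_mul.
have AU : forall h : 'I_D.+1, stable (A h) U.
  apply: (three_term_stable (F := fun h : 'I_D.+1 => A h)) => [|h|].
  - exact: distance_matrix0.
  - by rewrite one distance_matrix_mul.
  - by rewrite one.
have [c ->] := bmP (idempotent_bm k).
move=> u uU; rewrite mulmx_suml; apply: memv_suml => h _.
by rewrite -scalemxAl rpredZ // AU.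
Qed.

(** * Dual distance matrices *)

Hypothesis krein : krein_parameters E (fun h i j => (inter_num e h i j)%:R).

Local Notation xr := (enum_rank x).

(** Terwilliger's A*_k with respect to [x]. *)
Definition dual_distance_matrix (k : 'I_D.+1) : 'M[C]_#|X| :=
  diag_mx (\row_y (N * E k xr y)).

Lemma krein_entry i j y z :
  E i y z * E j y z = N^-1 * \sum_(h < D.+1) (inter_num e h i j)%:R * E h y z.
Proof.
have /matrixP/(_ y z) := krein i j; rewrite !mxE summxE => ->.
by congr (_ * _); apply: eq_bigr => h _; rewrite !mxE.
Qed.

(** Since p^h_0k is 1 for h = k and 0 otherwise, entrywise multiplication by [E ord0] scales every
    [E k] by 1/N; the all-ones matrix is a combination of the [E k]. *)
Lemma idempotent0_entry y z : N * E ord0 y z = 1.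
Proof.
have E0 k : E ord0 y z * E k y z = N^-1 * E k y z.
  rewrite krein_entry (bigD1 k) //= big1 => [|h hk].
    by rewrite (inter_num0 conn dreg k x) ?eqxx ?mul1r ?addr0 // diamD -ltnS.
  by rewrite (inter_num0 conn dreg k x) ?(inj_eq val_inj) ?(negPf hk) ?mul0r // diamD -ltnS.
have [c cE] : exists c : 'I_D.+1 -> C, const_mx 1 = \sum_k c k *: E k.
  apply: bm_spanP; rewrite -distance_matrix_sum.
  by apply: memv_suml => k _; apply: distance_matrix_bm.
have /matrixP/(_ y z) := cE; rewrite mxE summxE => one.
have : E ord0 y z * (\sum_k (c k *: E k) y z) = N^-1 * (\sum_k (c k *: E k) y z).
  rewrite !mulr_sumr; apply: eq_bigr => k _.
  by rewrite mxE mulrCA E0 mulrCA.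
by rewrite -one !mulr1 => ->; rewrite mulfV // order_neq0.
Qed.

Lemma dual_distance_matrix0 : dual_distance_matrix ord0 = 1%:M.
Proof. by apply/matrixP => y z; rewrite !mxE idempotent0_entry. Qed.

Lemma dual_distance_matrix_mul k l :
  dual_distance_matrix k *m dual_distance_matrix l
  = \sum_(h < D.+1) (inter_num e h k l)%:R *: dual_distance_matrix h.
Proof.
rewrite mulmx_diag; apply/matrixP => y z; rewrite summxE !mxE.
case: (eqVneq y z) => [<-|yz]; last first.
  by rewrite big1 // => h _; rewrite !mxE (negPf yz) mulr0n mulr0.
rewrite mulr1n mulrACA krein_entry mulrACA mulfV ?order_neq0 // mul1r mulr_sumr.
by apply: eq_bigr => h _; rewrite !mxE eqxx mulr1n mulrCA.
Qed.

(* The squared norm of E_k A*_1 E_l is, up to a constant, the (x,x)-entry of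
   E_1 (E_k o E_l) E_1, where o is the entrywise product: a multiple of q^1_{kl}. *)
Lemma dual_distance_matrix_tridiagonal (k l : 'I_D.+1) : (k.+1 < l)%N || (l.+1 < k)%N ->
  E k *m dual_distance_matrix (inord 1) *m E l = 0.
Proof.
move=> kl; have one : val (inord 1 : 'I_D.+1) = 1%N by rewrite /= inordK.
set S := dual_distance_matrix _; set M := _ *m _ *m _.
have E_tr h : (E h)^T = E h by apply/bm_tr/idempotent_bm.
have E_sym h y z : E h y z = E h z y by rewrite -{1}E_tr mxE.
have S_conj : map_mx Num.conj S = S.
  apply/matrixP => y z; rewrite !mxE rmorphMn /= rmorphM /= conjC_nat.
  by rewrite -{2}idempotent_conj mxE.
have M_conj : map_mx Num.conj M = M by rewrite !map_mxM !idempotent_conj S_conj.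
have trM : \tr (M *m M^T) = 0.
  rewrite /M !trmx_mul !E_tr tr_diag_mx -/S.
  have -> : E k *m S *m E l *m (E l *m (S *m E k)) = E k *m S *m E l *m S *m E k.
    by rewrite !mulmxA -(mulmxA _ (E l) (E l)) idempotent_mul eqxx.
  rewrite mxtrace_mulC !mulmxA idempotent_mul eqxx.
  have -> : \tr (E k *m S *m E l *m S)
    = N ^+ 2 * (E (inord 1) *m map2_mx *%R (E k) (E l) *m E (inord 1)) xr xr.
    rewrite /mxtrace -mulmxA !mul_mx_diag !mxE mulr_sumr.
    transitivity (\sum_y \sum_z N ^+ 2
        * (E (inord 1) xr z * (E k z y * E l z y) * E (inord 1) y xr)); last first.
      apply: eq_bigr => y _; rewrite !mxE mulr_suml mulr_sumr.
      by apply: eq_bigr => z _; rewrite !mxE.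
    rewrite exchange_big; apply: eq_bigr => z _; rewrite !mxE.
    apply: eq_bigr => y _; rewrite !mxE.
    rewrite (E_sym l y) (E_sym _ y xr) (E_sym (inord 1) xr z).
    by rewrite expr2; ring.
  rewrite krein -scalemxAr -scalemxAl mulmx_sumr mulmx_suml.
  rewrite (big1 _ xpredT) ?scaler0 ?mxE ?mulr0 // => h _.
  rewrite -scalemxAr -scalemxAl idempotent_mul; case: eqP => [<-|_]; last by rewrite mul0mx scaler0.
  rewrite one; case: posnP (@inter_num_far _ _ conn 1 k l) => [->|_ /(_ isT)[]].
    by rewrite scale0r.
  by lia.
by apply: mxtrace_gram_eq0; rewrite M_conj.
Qed.

(** A*_1 serves: its eigenvalue on the k-th sphere is N times the coefficient of [A k] in
    [E (inord 1)]. *)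
Lemma tridiagonal_pair_half_dual :
  tridiagonal_pair_half E (fun k : 'I_D.+1 => dual_idempotent C e x k).
Proof.
have [c cE] := bmP (idempotent_bm (inord 1)).
exists (dual_distance_matrix (inord 1)), (fun k => N * c k).
split=> [k l|k|U U1 k]; first exact: dual_distance_matrix_tridiagonal.
  rewrite mulmx_diag -[RHS]linearZ /=; congr diag_mx; apply/rowP => y; rewrite !mxE.
  rewrite -!mulrA; congr (N * _).
  have /matrixP/(_ xr y) := cE; rewrite summxE => ->.
  have [h dh dsum] := sum_dist_eq x (enum_val y) c.
  under eq_bigr do rewrite !mxE enum_rankK.
  rewrite dsum dh (inj_eq val_inj); case: eqP => [->|] //=.
  by rewrite !mulr0.
have U_stable : forall h, stable (dual_distance_matrix h) U.
  apply: three_term_stable => // [|h]; first exact: dual_distance_matrix0.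
  by rewrite dual_distance_matrix_mul inordK.
have [d dE] := bm_spanP (distance_matrix_bm k).
(* Row [x] of the expansion of [A k] in the idempotents, written on the diagonal. *)
have -> : dual_idempotent C e x k = \sum_h (d h / N) *: dual_distance_matrix h.
  apply/matrixP => y z; rewrite summxE !mxE.
  case: (eqVneq y z) => [<-|yz]; last first.
  by rewrite big1 // => h _; rewrite !mxE (negPf yz) mulr0n mulr0.
  have /matrixP/(_ xr y) := dE; rewrite mxE enum_rankK summxE mulr1n => ->.
  by apply: eq_bigr => h _; rewrite !mxE eqxx mulr1n mulrA mulfVK // order_neq0.
move=> u uU; rewrite mulmx_suml; apply: memv_suml => h _.
by rewrite -scalemxAl rpredZ // U_stable.
Qed.

Theorem graph_tridiagonal_pair :
  tridiagonal_pair (fun k : 'I_D.+1 => dual_idempotent C e x k) E.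
Proof.
split; [exact: dual_idempotent_resolution | exact: idempotent_resolution
  | exact: tridiagonal_pair_half_graph | exact: tridiagonal_pair_half_dual].
Qed.

End Idempotents.
End BoseMesner.

(** At [b = 0] the formula gives c_2 = 0, but c_2 is positive since some pair has distance 2. Hence
    [q] is invertible, as its negative powers require. *)
Lemma classical_parameters_neq0 (C : numClosedFieldType) (X : finType) (e : rel X) (x : X)
    (D : nat) (b beta : C) : connected_simple_graph e -> distance_regular e ->
  (1 < D)%N -> classical_parameters e D b (b - 1) beta -> b != 0.
Proof.
move=> conn dreg D1 [diamD /(_ 2 D1)[c2 _]]; apply/eqP => b0; move: c2 => /eqP.
rewrite /gauss_int !big_ord_recl !big_ord0 b0 !(expr0, expr1, addr0, sub0r, mulr1) subrr mulr0.
rewrite pnatr_eq0 -leqn0 leqNgt /c_num (inter_num_neigh conn dreg x) // diamD.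
exact: D1.
Qed.

Theorem theorem7p2 (R : realType) (X : finType) (e : rel X) (D : nat)
  (b beta q : R[i])
  (E : 'I_D.+1 -> 'M[R[i]]_#|X|)
  (kr : 'I_D.+1 -> 'I_D.+1 -> 'I_D.+1 -> R[i])
  (x : X) (B Bs K Ks : 'M[R[i]]_#|X|) :
  connected_simple_graph e ->
  distance_regular e ->
  (3 <= D)%N ->
  b != 1 ->
  classical_parameters e D b (b - 1) beta ->
  q ^+ 2 = b ->
  primitive_idempotents e E ->
  krein_parameters E kr ->
  (forall h i j : 'I_D.+1, kr h i j = (inter_num e h i j)%:R) ->
  let Es := fun k : 'I_D.+1 => dual_idempotent R[i] e x k in
  acts_on_split Es E down up (fun i j => q ^ (i - j)) B ->
  acts_on_split Es E up down (fun i j => q ^ (j - i)) Bs ->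
  acts_on_split Es E down down (fun i j => q ^ (i - j)) K ->
  acts_on_split Es E up up (fun i j => q ^ (i - j)) Ks ->
  [/\ B^T = Bs, Ks \in unitmx & K^T = invmx Ks].
Proof.
move=> conn dreg D3 _ classic q2 primE krein krE Es.
have q0 : q != 0.
  have : b != 0 by apply: (classical_parameters_neq0 x conn dreg _ classic); lia.
  by rewrite -q2 expf_eq0.
apply: split_operators_transpose => //.
case: classic => diamD _; apply: graph_tridiagonal_pair => //; first by lia.
move=> i j; rewrite krein; congr (_ *: _); apply: eq_bigr => h _.
by rewrite krE.
Qed.
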